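(* Let $\{P_n\}_{n\ge 0}$ be a monic $2$-orthogonal polynomial sequence and let $Q_n(x):=\frac{1}{n+1}P_{n+1}'(x)$ for $n\ge 0$. Let $\vartheta_1,\vartheta_2$ be constants with $\vartheta_1,\vartheta_2\ne\frac{n-1}{n}$ for all integers $n\ge 1$, and define $$\vartheta_n=\left(\frac{1-(-1)^n}{2}\right)\frac{1-\frac{n+1}{2}(1-\vartheta_1)}{1-\frac{n-1}{2}(1-\vartheta_1)}+\left(\frac{1+(-1)^n}{2}\right)\frac{1-\frac n2(1-\vartheta_2)}{1-(\frac n2-1)(1-\vartheta_2)},\qquad n\ge 1.$$ Then the following two statements are equivalent: (i) $\{P_n\}_{n\ge 0}$ satisfies $P_0(x)=1$, $P_1(x)=x$, $P_2(x)=x^2$ and $P_{n+1}(x)=xP_n(x)-\gamma_{n-1}P_{n-2}(x)$ for $n\ge 2$, where the coefficients $\gamma_n$ $(n\ge1)$ satisfy $$\gamma_{n+2}=\frac{n+3}{n+1}\;\frac{n(\vartheta_n-1)+1}{(n+4)(\vartheta_{n+1}-1)+1}\;\gamma_{n+1},\qquad n\ge 0$$ (for $n=0$ the numerator $n(\vartheta_n-1)+1$ is read as $1$). (ii) The sequence $\{Q_n\}_{n\ge 0}$ is $2$-orthogonal and satisfies $Q_k(x)=x^k$ for $k=0,1,2$ and $Q_{n+1}(x)=xQ_n(x)-\widetilde\gamma_{n-1}Q_{n-2}(x)$ for $n\ge 2$, with $$\widetilde\gamma_n=\frac{n}{n+2}\,\vartheta_n\,\gamma_{n+1},\qquad n\ge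 1,$$ where $\gamma_n$ $(n\ge 1)$ denotes the coefficient of $P_{n-1}$ in the recurrence relation of $\{P_n\}_{n\ge 0}$, written $P_{n+2}(x)=(x-\beta_{n+1})P_{n+1}(x)-\alpha_{n+1}P_{n}(x)-\gamma_{n}P_{n-1}(x)$.
   Context: A sequence of monic polynomials $\{P_n\}_{n\ge0}$ (complex coefficients, $\deg P_n=n$) is $2$-orthogonal if there are linear functionals $u_0,u_1$ on the space $\mathcal P$ of polynomials such that, for all $m,n\ge 0$: $\langle u_0,x^mP_n\rangle=0$ if $n\ge 2m+1$ and $\langle u_0,x^mP_{2m}\rangle\neq 0$; $\langle u_1,x^mP_n\rangle=0$ if $n\ge 2m+2$ and $\langle u_1,x^mP_{2m+1}\rangle\ne 0$. Equivalently, there are coefficients $\beta_n,\alpha_n,\gamma_n$ with $\gamma_n\ne 0$ for all $n\ge1$ such that $P_{n+1}(x)=(x-\beta_n)P_n(x)-\alpha_nP_{n-1}(x)-\gamma_{n-1}P_{n-2}(x)$ for $n\ge 0$, with $P_{-2}=P_{-1}=0$, $P_0=1$. *)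

(* Defs.v *)
From HB Require Import structures.
From mathcomp Require Import all_boot all_order all_algebra.
From mathcomp Require Import complex reals.

Set Implicit Arguments.
Unset Strict Implicit.
Unset Printing Implicit Defensive.

Import Order.TTheory GRing.Theory Num.Theory.
Local Open Scope ring_scope.

Definition monic_seq (F : fieldType) (P : nat -> {poly F}) : Prop :=
  forall n : nat, P n \is monic /\ size (P n) = n.+1.

Definition two_orthogonal (F : fieldType) (P : nat -> {poly F}) : Prop :=
  monic_seq P /\
  exists u0 u1 : {scalar {poly F}},
    forall m : nat,
      [/\ forall n : nat, (m.*2.+1 <= n)%N -> u0 ('X^m * P n) = 0,
          u0 ('X^m * P m.*2) != 0,
          forall n : nat, (m.*2.+2 <= n)%N -> u1 ('X^m * P n) = 0
        & u1 ('X^m * P m.*2.+1) != 0].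

(* The recurrence
     P_{n+1} = (x - beta_n) P_n - alpha_n P_{n-1} - gamma_{n-1} P_{n-2}, n >= 0,
   with P_0 = 1 and P_{-1} = P_{-2} = 0, written out for n = 0, n = 1 and n >= 2;
   the values alpha 0 and gamma 0 play no role. *)
Definition recurrence_coefficients (F : fieldType) (P : nat -> {poly F})
    (beta alpha gamma : nat -> F) : Prop :=
  [/\ P 0%N = 1,
      P 1%N = 'X - (beta 0%N)%:P,
      P 2%N = ('X - (beta 1%N)%:P) * P 1%N - alpha 1%N *: P 0%N
    & forall n : nat,
        P n.+3 = ('X - (beta n.+2)%:P) * P n.+2 - alpha n.+2 *: P n.+1
                 - gamma n.+1 *: P n].

Definition threefold_recurrence (F : fieldType) (P : nat -> {poly F})
    (g : nat -> F) : Prop :=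
  [/\ P 0%N = 1, P 1%N = 'X, P 2%N = 'X^2
    & forall n : nat, P n.+3 = 'X * P n.+2 - g n.+1 *: P n].

Definition derived_seq (F : fieldType) (P : nat -> {poly F}) (n : nat) :
    {poly F} :=
  (n.+1%:R)^-1 *: (P n.+1)^`().

(* For each n only one of the two summands is present; the fraction in the
   other one may have a zero denominator, but it is multiplied by 0. *)
Definition vartheta (F : fieldType) (t1 t2 : F) (n : nat) : F :=
  (1 - (-1) ^+ n) / 2%:R *
    ((1 - (n%:R + 1) / 2%:R * (1 - t1)) / (1 - (n%:R - 1) / 2%:R * (1 - t1)))
  + (1 + (-1) ^+ n) / 2%:R *
    ((1 - n%:R / 2%:R * (1 - t2)) / (1 - (n%:R / 2%:R - 1) * (1 - t2))).

(* Main.v *)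
Require Import Defs.
From HB Require Import structures.
From mathcomp Require Import all_boot all_order all_algebra.
From mathcomp Require Import complex reals.
From mathcomp Require Import ring.

Set Implicit Arguments.
Unset Strict Implicit.
Unset Printing Implicit Defensive.

Import Order.TTheory GRing.Theory Num.Theory.
Local Open Scope ring_scope.

(** If [P_(n+3) = x P_(n+2) - g_(n+1) P_n] and [Q_n = P_(n+1)' / (n+1)]
    satisfies the same kind of recurrence with coefficients [h], differentiating
    gives [P_(n+3) = Q_(n+3) + c_n Q_n] where
    [c_n = (n+1) g_(n+2) - (n+3) h_(n+1)].  Inserting this in the recurrence of
    [P] yields [c_(n+1) = c_n + h_(n+2) - g_(n+2)] and
    [c_(n+2) h_(n+1) = g_(n+4) c_n]; conversely these two relations suffice for
    the recurrence of [Q].  With [h_n = n/(n+2) vartheta_n g_(n+1)] the first one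
    is the recurrence of (i), and the second one is the identity
    [(1 - vartheta_(n+2)) vartheta_n = 1 - vartheta_n], satisfied by [vartheta].
    The 2-orthogonality of [Q] follows since any such recurrence with nonzero
    coefficients makes the first two dual functionals orthogonalizing. *)

(** * Dual functionals, 2-orthogonality and nonzero recurrence coefficients *)

Section Functionals.
Variable F : fieldType.
Implicit Types (P Q : nat -> {poly F}) (g v : nat -> F).

Definition moment_functional (mu : nat -> F) (p : {poly F}) : F :=
  \sum_(i < size p) p`_i * mu i.

Lemma moment_functionalE mu (p : {poly F}) N : (size p <= N)%N ->
  moment_functional mu p = \sum_(i < N) p`_i * mu i.
Proof.
move=> le_pN; rewrite /moment_functional.
rewrite (big_ord_widen _ (fun i => p`_i * mu i) le_pN) big_mkcond /=.
apply: eq_bigr => i _; case: ltnP => // le_pi.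
by rewrite nth_default ?mul0r.
Qed.

Lemma moment_functional_is_linear mu : scalar (moment_functional mu).
Proof.
move=> a p q; set N := maxn (size p) (size q).
have leN (r : {poly F}) : (size r <= N)%N ->
  moment_functional mu r = \sum_(i < N) r`_i * mu i.
  exact: moment_functionalE.
rewrite !leN ?leq_maxl ?leq_maxr //; last first.
  rewrite (leq_trans (size_polyD _ _)) // geq_max leq_maxr andbT.
  by rewrite (leq_trans (size_scale_leq _ _)) ?leq_maxl.
rewrite mulr_sumr -big_split; apply: eq_bigr => i _ /=.
by rewrite coefD coefZ mulrDl mulrA.
Qed.

(** Forward substitution: for monic [P m], the equation u(P_m) = v_m determines the moment of order
    [m] from the earlier ones, which are therefore all kept in the list. *)
Fixpoint moments P v (n : nat) : seq F :=
  if n is m.+1 then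
    rcons (moments P v m) (v m - \sum_(i < m) (P m)`_i * (moments P v m)`_i)
  else [::].

Lemma size_moments P v n : size (moments P v n) = n.
Proof. by elim: n => //= n IHn; rewrite size_rcons IHn. Qed.

Lemma nth_moments P v n i : (i < n)%N ->
  (moments P v n)`_i = (moments P v i.+1)`_i.
Proof.
elim: n => // n IHn; rewrite ltnS leq_eqVlt => /predU1P[-> // | lt_in].
by rewrite [in LHS]/= nth_rcons size_moments lt_in IHn.
Qed.

Lemma functional_of_values P v : monic_seq P ->
  exists u : {scalar {poly F}}, forall n, u (P n) = v n.
Proof.
move=> monP; pose mu i := (moments P v i.+1)`_i.
pose uM := GRing.isLinear.Build F {poly F} F _ (moment_functional mu)
  (moment_functional_is_linear mu).
pose u : {scalar {poly F}} := HB.pack (moment_functional mu) uM.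
exists u => n; rewrite /= /moment_functional.
have [/monicP lcP sP] := monP n; rewrite sP big_ord_recr /=.
rewrite /lead_coef sP /= in lcP.
rewrite lcP mul1r [mu n]/= {2}/mu /= nth_rcons size_moments ltnn eqxx addrC.
rewrite -[RHS](subrK (\sum_(i < n) (P n)`_i * (moments P v n)`_i)).
congr (_ + _); apply: eq_bigr => i _; by rewrite /mu nth_moments.
Qed.

Lemma monic_seq_threefold P g : threefold_recurrence P g -> monic_seq P.
Proof.
case=> P0 P1 P2 PS n.
suff: [/\ P n \is monic /\ size (P n) = n.+1,
          P n.+1 \is monic /\ size (P n.+1) = n.+2
        & P n.+2 \is monic /\ size (P n.+2) = n.+3] by case.
elim: n => [|n [[mP0 sP0] IH1 [mP2 sP2]]].
  by rewrite P0 P1 P2 monic1 monicX monicXn size_poly1 size_polyX size_polyXn.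
split=> //; rewrite PS.
have sXP : size ('X * P n.+2) = n.+4.
  by rewrite mulrC size_mulX ?sP2 ?monic_neq0.
have lt_s : (size (- (g n.+1 *: P n)) < size ('X * P n.+2)%R)%N.
  rewrite sXP size_polyN (leq_ltn_trans (size_scale_leq _ _)) // sP0.
  by rewrite ltnS ltnW.
rewrite size_polyDl // sXP; split=> //.
by rewrite monicE lead_coefDl // lead_coefM lead_coefX (monicP mP2) mulr1.
Qed.

(** By the recurrence, each factor x lowers the smallest index present by two at the cost of one
    factor [g]. So x^m P_(2m+r) reaches P_r with a nonzero product of [g]'s, and larger indices stay
    above [r]. *)
Lemma threefold_functional P g (u : {scalar {poly F}}) r :
  threefold_recurrence P g -> (forall n, g n.+1 != 0) ->
  (forall n, u (P n) = (n == r)%:R) ->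
  forall m, (forall n, (m.*2 + r < n)%N -> u ('X^m * P n) = 0) /\
            u ('X^m * P (m.*2 + r)%N) != 0.
Proof.
move=> [_ _ _ PS] g0 uP.
have shift (m n : nat) : u ('X^(m.+1) * P n.+2) =
    u ('X^m * P n.+3) + g n.+1 * u ('X^m * P n).
  rewrite -[g _ * _]linearZ -linearD /= scalerAr -mulrDr PS subrK.
  by rewrite exprSr mulrA.
elim=> [|m [IH0 IH1]].
  split=> [n lt_rn|]; rewrite expr0 mul1r uP ?eqxx ?oner_eq0 //.
  by rewrite gtn_eqF.
split=> [[|[|n]]|].
- by [].
- by rewrite doubleS.
- rewrite doubleS !addSn !ltnS => lt_n; rewrite shift !IH0 ?mulr0 ?addr0 //.
  by rewrite ltnW // ltnW // ltnW.
rewrite doubleS !addSn shift IH0 ?add0r ?mulf_neq0 //.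
by rewrite ltnW // ltnW.
Qed.

Lemma two_orthogonal_threefold P g :
  threefold_recurrence P g -> (forall n, g n.+1 != 0) -> two_orthogonal P.
Proof.
move=> PS g0; have monP := monic_seq_threefold PS; split=> //.
have [u0 u0P] := functional_of_values (fun n => (n == 0)%:R) monP.
have [u1 u1P] := functional_of_values (fun n => (n == 1)%:R) monP.
exists u0, u1 => m.
have [] := threefold_functional PS g0 u0P m; rewrite addn0 => v0 n0.
by have [] := threefold_functional PS g0 u1P m; rewrite addn1.
Qed.

(** With m = n/2 rounded down, apply to x^(m+1) P_(n+2) the functional [u0] if [n] is even and [u1]
    if odd: the value is nonzero, and every term of its expansion vanishes except the one carrying
    [gamma n.+1]. *)
Lemma gamma_neq0 P beta alpha gamma :
  two_orthogonal P -> recurrence_coefficients P beta alpha gamma ->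
  forall n, gamma n.+1 != 0.
Proof.
move=> [_ [u0 [u1 ou]]] [_ _ _ PS] n.
have shift (u : {scalar {poly F}}) m : u ('X^(m.+1) * P n.+2) =
    u ('X^m * P n.+3) + beta n.+2 * u ('X^m * P n.+2)
    + alpha n.+2 * u ('X^m * P n.+1) + gamma n.+1 * u ('X^m * P n).
  have -> : 'X^(m.+1) * P n.+2 = 'X^m * P n.+3 + beta n.+2 *: ('X^m * P n.+2)
      + alpha n.+2 *: ('X^m * P n.+1) + gamma n.+1 *: ('X^m * P n).
    by rewrite PS exprSr -!mul_polyC; ring.
  by rewrite !linearD !linearZ.
pose m := n./2; have := odd_double_half n; rewrite -/m.
have [o0 n0 o1 n1] := ou m; have [_ n0' _ n1'] := ou m.+1.
case: (odd n) => /= def_n; rewrite ?add0n ?add1n in def_n.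
  apply: contraNneq n1' => g0; rewrite doubleS def_n shift.
  by rewrite g0 mul0r !o1 ?mulr0 ?addr0 // -def_n; do ?[exact: leqnn | apply: leqW].
apply: contraNneq n0' => g0; rewrite doubleS def_n shift.
by rewrite g0 mul0r !o0 ?mulr0 ?addr0 // -def_n; do ?[exact: leqnn | apply: leqW].
Qed.

End Functionals.

(** * Threefold recurrences and derivatives *)

Section Derived.
Variable F : numFieldType.
Implicit Types (P : nat -> {poly F}) (g h : nat -> F).

(** Derives an equation from a combination of known ones, leaving an identity for [ring] or
    [field]. *)
Lemma eq_by_sub (V : zmodType) (x y z t : V) :
  z = t -> x - y = z - t -> x = y.
Proof. by move=> -> /eqP; rewrite subrr subr_eq0 => /eqP. Qed.

Lemma natrS_neq0 n : n.+1%:R != 0 :> F.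
Proof. by rewrite pnatr_eq0. Qed.

Lemma deriv_derived_seq P n : (P n.+1)^`() = n.+1%:R *: derived_seq P n.
Proof. by rewrite scalerA divff ?natrS_neq0 // scale1r. Qed.

Lemma coef_derived_seq P n i :
  n.+1%:R * (derived_seq P n)`_i = i.+1%:R * (P n.+1)`_i.+1.
Proof. by rewrite -coefZ -deriv_derived_seq coef_deriv mulr_natl. Qed.

Lemma coef_derived_seq_eq0 P n i :
  (derived_seq P n)`_i = 0 -> (P n.+1)`_i.+1 = 0.
Proof.
move=> Q0; have /eqP := coef_derived_seq P n i.
by rewrite Q0 mulr0 eq_sym mulf_eq0 (negPf (natrS_neq0 _)) => /eqP.
Qed.

Lemma coef_threefold P g : threefold_recurrence P g ->
  [/\ forall n, (P n)`_n = 1, forall n, (P n.+1)`_n = 0,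
      forall n, (P n.+2)`_n = 0 & forall n i, (n < i)%N -> (P n)`_i = 0].
Proof.
move=> hP; have monP := monic_seq_threefold hP; have [P0 P1 P2 PS] := hP.
have big n i : (n < i)%N -> (P n)`_i = 0.
  by move=> lt_ni; rewrite nth_default // (monP n).2.
have c1 n : (P n.+1)`_n = 0.
  elim: n => [|[|n] IHn]; rewrite ?P1 ?P2 ?coefX ?coefXn // PS.
  by rewrite coefB coefXM coefZ /= IHn big ?mulr0 ?subr0.
have c2 n : (P n.+2)`_n = 0.
  elim: n => [|[|n] IHn]; rewrite ?P2 ?coefXn // PS coefB coefXM coefZ /=.
    by rewrite IHn big ?mulr0 ?subr0.
  by rewrite IHn big ?mulr0 ?subr0.
split=> // n; have [/monicP] := monP n; rewrite /lead_coef => lcP sP.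
by rewrite sP in lcP.
Qed.

(* Compare the coefficients of [x^n] in [P_(n+3)] and in [Q_(n+3)]. *)
Lemma derived_threefold_coefficients P g h :
  threefold_recurrence P g -> threefold_recurrence (derived_seq P) h ->
  h 0 = 0 ->
  forall n, (n%:R + 1) * g n.+2 - (n%:R - 1) * g n.+1 =
            (n%:R + 4%:R) * h n.+1 - (n%:R + 2%:R) * h n.
Proof.
move=> hP hQ h0.
have [P1 _ _ _] := coef_threefold hP; have [Q1 _ _ _] := coef_threefold hQ.
case: hP => _ _ _ PS; case: hQ => _ _ _ QS.
pose a n := (P n.+3)`_n; pose B n := ('X * derived_seq P n.+2)`_n.
have aS n : a n.+1 = a n - g n.+2.
  by rewrite /a PS coefB coefXM coefZ P1 mulr1.
have a0 : a 0 = - g 1 by rewrite /a PS coefB coefXM coefZ P1 mulr1 sub0r.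
have Qn n : (derived_seq P n.+3)`_n = B n - h n.+1.
  by rewrite QS coefB coefZ Q1 mulr1.
have B0 : B 0 = 0 by rewrite /B coefXM.
have BS n : B n.+1 = B n - h n.+1 by rewrite /B coefXM -Qn.
have E1 n : (n%:R + 4%:R) * B n.+1 = (n%:R + 1) * a n.+1.
  by rewrite BS -Qn -natrD -(natrD _ n 1) addn4 addn1 coef_derived_seq.
have E2 n : (n%:R + 3%:R) * B n = n%:R * a n.
  case: n => [|n]; first by rewrite B0 mulr0 mul0r.
  by rewrite -natrD !addn3 -addn4 natrD E1 -[n.+1%:R]natr1.
(* Subtracting [E2] from [E1] frees [a n - B n] of its factors; comparing its values at consecutive
   indices then gives the claim. *)
have E n : a n - B n = (n%:R + 1) * g n.+2 - (n%:R + 4%:R) * h n.+1.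
  have := E1 n; have := E2 n; rewrite aS BS => e2 e1.
  by apply: (eq_by_sub (congr2 +%R e2 (esym e1))); ring.
case=> [|n].
  have := E 0; rewrite a0 B0 h0 => e; apply: (eq_by_sub (esym e)); ring.
have := E n; have := E n.+1; rewrite aS BS -[n.+1%:R]natr1 => e1 e2.
by apply: (eq_by_sub (congr2 +%R e2 (esym e1))); ring.
Qed.

(* The second-order terms of [P] and [Q] kill [beta_n] for [n >= 2] and
   [alpha_n] for [n >= 3]; the vanishing of [Q_4] and [Q_5] at [0] then kills
   [P_1] and [P_2] at [0]. *)
Lemma threefold_of_derived P beta alpha g h :
  recurrence_coefficients P beta alpha g -> (forall n, g n.+1 != 0) ->
  threefold_recurrence (derived_seq P) h -> threefold_recurrence P g.
Proof.
move=> [P0 P1 P2 PS] g0 hQ.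
have [_ Q1 Q2 Qbig] := coef_threefold hQ; have [_ Q1E Q2E QS] := hQ.
have sP n i : (n < i)%N -> (P n)`_i = 0.
  case: n i => [|n] [|i] // lt_ni; first by rewrite P0 coef1.
  by apply/coef_derived_seq_eq0/Qbig.
have lP n : (P n)`_n = 1.
  case: n => [|n]; first by rewrite P0 coef1.
  have := coef_derived_seq P n n; have [-> _ _ _] := coef_threefold hQ.
  by move/(mulfI (natrS_neq0 n)).
have subP n : (P n.+2)`_n.+1 = 0 by apply: coef_derived_seq_eq0.
have subP2 n : (P n.+3)`_n.+1 = 0 by apply: coef_derived_seq_eq0.
have coefPS n i : (P n.+3)`_i = ('X * P n.+2)`_i - beta n.+2 * (P n.+2)`_i
    - alpha n.+2 * (P n.+1)`_i - g n.+1 * (P n)`_i.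
  by rewrite PS mulrBl !coefB mul_polyC !coefZ.
have beta0 n : beta n.+2 = 0.
  have := coefPS n n.+2; rewrite subP coefXM /= subP lP !sP // mulr1 !mulr0.
  by rewrite !subr0 sub0r => /esym/eqP; rewrite oppr_eq0 => /eqP.
have alphaE n : alpha n.+2 = ('X * P n.+2)`_n.+1.
  have := coefPS n n.+1; rewrite subP2 beta0 mul0r lP [(P n)`__]sP // mulr0.
  by rewrite mulr1 !subr0 => /esym/eqP; rewrite subr_eq0 => /eqP.
have alpha0 n : alpha n.+3 = 0 by rewrite alphaE coefXM subP2.
have step n : P n.+4 = 'X * P n.+3 - g n.+2 *: P n.+1.
  by rewrite PS beta0 alpha0 scale0r !subr0.
(* Both [P n.+2] and [P n.+4.+1] lose their linear term, so the recurrence gives P_(n+4)(0) = 0,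
   which equals - g_(n+2) P_(n+1)(0). *)
have zero n : (derived_seq P n.+1)`_0 = 0 -> (P n.+1)`_0 = 0.
  move=> Qn; have Qn3 : (derived_seq P n.+4)`_0 = 0.
    by rewrite QS coefB coefXM [X in _ - X]coefZ Qn mulr0 subr0.
  have /eqP := coef_derived_seq_eq0 Qn3; rewrite step coefB coefXM coefZ /=.
  rewrite (coef_derived_seq_eq0 Qn) mulr0 subr0 step coefB coefXM coefZ sub0r.
  by rewrite oppr_eq0 mulf_eq0 (negPf (g0 _)) => /eqP.
have P10 : (P 1)`_0 = 0 by apply: zero; rewrite Q1E coefX.
have P20 : (P 2)`_0 = 0 by apply: zero; rewrite Q2E coefXn.
have PE (p : {poly F}) n : (forall i, (n < i)%N -> p`_i = 0) -> p`_n = 1 ->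
    (forall i, (i < n)%N -> p`_i = 0) -> p = 'X^n.
  move=> gtn eqn ltn'; apply/polyP => i; rewrite coefXn.
  by case: ltngtP => [/ltn'|/gtn|->].
split=> //.
- rewrite -[RHS]expr1; apply: PE => [i|//|[|i] //]; exact: sP.
- by apply: PE => [i|//|[|[|i]] //]; exact: sP.
(* [step] starts at [P 4]; for [P 3] the remaining coefficient [alpha 2] is P_2(0). *)
case=> [|n]; last exact: step.
by rewrite PS beta0 alphaE coefXM P20 scale0r !subr0.
Qed.

Lemma derived_threefold P g h :
  threefold_recurrence P g -> h 0 = 0 ->
  (forall n, (n%:R + 1) * g n.+2 - (n%:R - 1) * g n.+1 =
             (n%:R + 4%:R) * h n.+1 - (n%:R + 2%:R) * h n) ->
  (forall n, ((n%:R + 3%:R) * g n.+4 - (n%:R + 5%:R) * h n.+3) * h n.+1 =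
             g n.+4 * ((n%:R + 1) * g n.+2 - (n%:R + 3%:R) * h n.+1)) ->
  threefold_recurrence (derived_seq P) h.
Proof.
move=> hP h0 rel1 rel2.
pose Q := derived_seq P; pose c n := (n%:R + 1) * g n.+2 - (n%:R + 3%:R) * h n.+1.
have [P0 P1 P2 PS] := hP.
have [Q0 Q1 Q2] : [/\ Q 0 = 1, Q 1 = 'X & Q 2 = 'X^2].
  split; rewrite /Q /derived_seq ?P1 ?P2 ?PS ?derivX ?derivXn ?invr1 ?scale1r //.
    by rewrite -scaler_nat scalerA mulVf ?natrS_neq0 // scale1r expr1.
  rewrite P0 P2 derivB derivZ derivC scaler0 subr0 -exprS derivXn.
  by rewrite -scaler_nat scalerA mulVf ?natrS_neq0 // scale1r.
have PQ n : P n.+3 = (n%:R + 4%:R) *: Q n.+3 - (n%:R + 3%:R) *: ('X * Q n.+2)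
    + ((n%:R + 1) * g n.+2) *: Q n.
  have /(congr1 (@deriv F)) := PS n.+1.
  rewrite derivB derivM derivX mul1r derivZ !deriv_derived_seq -/Q => e.
  have -> : n%:R + 4%:R = n.+4%:R :> F by rewrite -natrD addn4.
  have -> : n%:R + 3%:R = n.+3%:R :> F by rewrite -natrD addn3.
  rewrite natr1; apply: (eq_by_sub (esym e)).
  by rewrite -!mul_polyC; ring.
(* Once the recurrence holds for [Q] up to index [n + 3], the relation [PQ]
   reads [P_(n+3) = Q_(n+3) + c_n Q_n]; substituting this in the recurrence of
   [P] gives the next case. *)
have PQc n : Q n.+3 = 'X * Q n.+2 - h n.+1 *: Q n -> P n.+3 = Q n.+3 + c n *: Q n.
  by move=> e; rewrite PQ e -!mul_polyC /c; ring.
have step n : 'X * P n.+2 - g n.+1 *: P n =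
     'X * Q n.+2 + ((n%:R + 1) * g n.+2 - (n%:R + 4%:R) * h n.+1) *: Q n ->
   Q n.+3 = 'X * Q n.+2 - h n.+1 *: Q n.
  rewrite -PS PQ => e.
  have /(scalerI (natrS_neq0 n.+3)) // :
    n.+4%:R *: Q n.+3 = n.+4%:R *: ('X * Q n.+2 - h n.+1 *: Q n).
  have -> : n.+4%:R = n%:R + 4%:R :> F by rewrite -natrD addn4.
  apply: (eq_by_sub e).
  by rewrite -!mul_polyC; ring.
rewrite -/Q; clearbody Q.
(* [PQc] starts at [P 3], so three base cases use the explicit [P 0], [P 1], [P 2]. *)
have rec0 : Q 3 = 'X * Q 2 - h 1 *: Q 0.
  apply: step; rewrite P0 P2 Q0 Q2 -!mul_polyC.
  have := rel1 0; rewrite h0 => e.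
  by apply: (eq_by_sub (congr1 polyC (esym e))); ring.
have rec1 : Q 4 = 'X * Q 3 - h 2 *: Q 1.
  apply: step; rewrite (PQc _ rec0) P1 Q0 Q1 /c -!mul_polyC.
  have := congr1 (fun z => z%:P * 'X) (esym (rel1 1)) => /= e.
  by apply: (eq_by_sub e); ring.
have rec2 : Q 5 = 'X * Q 4 - h 3 *: Q 2.
  apply: step; rewrite (PQc _ rec1) P2 Q1 Q2 /c -!mul_polyC.
  have := congr1 (fun z => z%:P * 'X^2) (esym (rel1 2)) => /= e.
  by apply: (eq_by_sub e); ring.
split=> // n; suff: [/\ Q n.+3 = 'X * Q n.+2 - h n.+1 *: Q n,
    Q n.+4 = 'X * Q n.+3 - h n.+2 *: Q n.+1
  & Q n.+4.+1 = 'X * Q n.+4 - h n.+3 *: Q n.+2] by case.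
elim: n => [|n [e0 e1 e2]]; split=> //.
apply: step; rewrite (PQc _ e0) (PQc _ e2).
(* [r0] expands x Q_(n+2); then [r1] matches the coefficients of Q_(n+3), and [r2] cancels those of
   Q_n. *)
have r0 := congr1 (fun q => (c n.+2)%:P * q) (esym e0).
have r1 := congr1 (fun z => z%:P * Q n.+3) (esym (rel1 n.+3)).
have r2 := congr1 (fun z => z%:P * Q n) (rel2 n).
rewrite -!mul_polyC /c in r0 r1 r2 |- *.
by apply: (eq_by_sub (congr2 +%R (congr2 +%R r0 r1) r2)); ring.
Qed.

(** On each parity class [vartheta] is a quotient d_(k+1)/d_k with d_k = 1 - k s, the form used
    below. *)
Lemma vartheta_parity t1 t2 (b : bool) k :
  vartheta t1 t2 (b + k.*2).+1 =
    let s := 1 - (if b then t2 else t1) : F in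
    (1 - k.+1%:R * s) / (1 - k%:R * s).
Proof.
have two : (1 + 1) / 2%:R = 1 :> F by apply: divff; exact: natrS_neq0 1.
rewrite /vartheta -signr_odd /= oddD odd_double.
case: b; rewrite /= ?expr0 ?expr1.
  rewrite subrr mul0r mul0r add0r two mul1r.
  rewrite (_ : (1 + k.*2).+1 = k.+1 * 2)%N ?muln2 // -muln2 natrM.
  by rewrite mulfK ?natrS_neq0 // -[in _ - 1]natr1 addrK.
rewrite subrr !mul0r addr0 opprK two mul1r add0n.
have -> : k.*2.+1%:R + 1 = k.+1%:R * 2%:R :> F.
  by rewrite natr1 -doubleS -muln2 natrM.
have -> : k.*2.+1%:R - 1 = k%:R * 2%:R :> F.
  by rewrite -natr1 addrK -muln2 natrM.
by rewrite !mulfK ?natrS_neq0.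
Qed.

(** * Nonvanishing and shift identity for [vartheta] *)

Section Vartheta.
Variables t1 t2 : F.
Hypothesis ht : forall n : nat, (1 <= n)%N ->
  t1 != (n%:R - 1) / n%:R /\ t2 != (n%:R - 1) / n%:R.

Lemma vartheta_den_neq0 (b : bool) n : 1 - n%:R * (1 - (if b then t2 else t1)) != 0.
Proof.
case: n => [|n]; first by rewrite mul0r subr0 oner_neq0.
have [n1 n2] := ht (ltn0Sn n).
have : (if b then t2 else t1) != (n.+1%:R - 1) / n.+1%:R by case: b.
apply: contraNneq => e; apply/eqP; apply: (mulIf (natrS_neq0 n)).
by rewrite divfK ?natrS_neq0 //; apply: (eq_by_sub e); ring.
Qed.

Lemma vartheta_neq0 n : vartheta t1 t2 n.+1 != 0.
Proof.
rewrite -(odd_double_half n) vartheta_parity /=.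
by rewrite mulf_neq0 ?invr_eq0 ?vartheta_den_neq0.
Qed.

(** For n = b + 2k this equals d_(b+4+3k)/d_k, a quotient of nonzero terms. *)
Lemma vartheta_rec_den_neq0 n :
  (n%:R + 4%:R) * (vartheta t1 t2 n.+1 - 1) + 1 != 0.
Proof.
rewrite -(odd_double_half n) vartheta_parity /=.
move: (odd n) n./2 => b k; have := vartheta_den_neq0 b (b + 4 + 3 * k).
have := vartheta_den_neq0 b k; set s := 1 - (if b then t2 else t1) => d0 d1.
suff -> : ((b + k.*2)%N%:R + 4%:R) * ((1 - k.+1%:R * s) / (1 - k%:R * s) - 1) + 1
    = (1 - (b + 4 + 3 * k)%N%:R * s) / (1 - k%:R * s).
  by rewrite mulf_neq0 ?invr_eq0.
by rewrite -mul2n !natrD -[k.+1%:R]natr1; field.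
Qed.

(** Here 1 - d_(k+1)/d_k = s/d_k, and (s/d_(k+1)) (d_(k+1)/d_k) = s/d_k. *)
Lemma vartheta_shift n :
  (1 - vartheta t1 t2 n.+3) * vartheta t1 t2 n.+1 = 1 - vartheta t1 t2 n.+1.
Proof.
have v1 := vartheta_parity t1 t2 (odd n) n./2.
have v3 := vartheta_parity t1 t2 (odd n) n./2.+1.
rewrite doubleS !addnS odd_double_half in v3; rewrite odd_double_half in v1.
rewrite v1 v3 /=.
move: (odd n) n./2 => b k.
have := vartheta_den_neq0 b k; have := vartheta_den_neq0 b k.+1.
rewrite -[k.+2%:R]natr1 -[k.+1%:R]natr1.
by set s := 1 - (if b then t2 else t1) => d0 d1; field; rewrite d0 d1.
Qed.

End Vartheta.

(* [x] stands for [n], [u] and [v] for the consecutive values of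
   [vartheta], and [y], [z] for [gamma_(n+1)], [gamma_(n+2)]. *)
Lemma gamma_recurrenceE (x u v y z : F) :
  x + 1 != 0 -> x + 2%:R != 0 -> x + 3%:R != 0 ->
  (x + 4%:R) * (v - 1) + 1 != 0 ->
  z = (x + 3%:R) / (x + 1) * ((x * (u - 1) + 1) / ((x + 4%:R) * (v - 1) + 1)) * y
  <->
  (x + 1) * z - (x - 1) * y =
    (x + 4%:R) * ((x + 1) / (x + 1 + 2%:R) * v * z)
    - (x + 2%:R) * (x / (x + 2%:R) * u * y).
Proof.
move=> x1 x2 x3 d; have x3' : x + 1 + 2%:R != 0.
  by move: x3; congr (_ != _); ring.
(* The defects of the two equations differ by a nonzero factor. *)
have E : (x + 1) * z - (x - 1) * y
    - ((x + 4%:R) * ((x + 1) / (x + 1 + 2%:R) * v * z)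
       - (x + 2%:R) * (x / (x + 2%:R) * u * y)) =
    (x + 1) / (x + 3%:R) * ((x + 4%:R) * (v - 1) + 1)
    * ((x + 3%:R) / (x + 1) * ((x * (u - 1) + 1) / ((x + 4%:R) * (v - 1) + 1)) * y
       - z).
  by field; rewrite x1 x2 x3 d.
split=> [e|/eqP].
  by apply/eqP; rewrite -subr_eq0 E -e subrr mulr0.
rewrite -subr_eq0 E !mulf_eq0 invr_eq0 (negPf x1) (negPf x3) (negPf d) /=.
by rewrite subr_eq0 => /eqP.
Qed.

End Derived.

Theorem theorem3p4 (R : realType) (P : nat -> {poly R[i]})
    (beta alpha gamma : nat -> R[i]) (t1 t2 : R[i])
    (hP : two_orthogonal P)
    (hrec : recurrence_coefficients P beta alpha gamma)
    (ht : forall n : nat, (1 <= n)%N ->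
       t1 != (n%:R - 1) / n%:R /\ t2 != (n%:R - 1) / n%:R) :
  (threefold_recurrence P gamma /\
   (forall n : nat,
      gamma n.+2 =
        (n%:R + 3%:R) / (n%:R + 1)
        * ((n%:R * (vartheta t1 t2 n - 1) + 1)
           / ((n%:R + 4%:R) * (vartheta t1 t2 n.+1 - 1) + 1))
        * gamma n.+1))
  <->
  (two_orthogonal (derived_seq P) /\
   threefold_recurrence (derived_seq P)
     (fun n : nat => n%:R / (n%:R + 2%:R) * vartheta t1 t2 n * gamma n.+1)).
Proof.
set h := fun n : nat => _.
have g0 := gamma_neq0 hP hrec.
have v0 := vartheta_neq0 ht.
have h0 : h 0 = 0 by rewrite /h !mul0r.
have natD n k : n%:R + k.+1%:R != 0 :> R[i] by rewrite -natrD addnS natrS_neq0.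
have rel n : _ <-> _ := gamma_recurrenceE (vartheta t1 t2 n) (gamma n.+1)
  (gamma n.+2) (natD n 0) (natD n 1) (natD n 2) (vartheta_rec_den_neq0 ht n).
have hS n : h n.+1 =
    (n%:R + 1) / (n%:R + 1 + 2%:R) * vartheta t1 t2 n.+1 * gamma n.+2.
  by rewrite /h -natr1.
split=> [[hPt hg] | [_ hQ]]; last first.
  have hPt := threefold_of_derived hrec g0 hQ; split=> // n.
  have := derived_threefold_coefficients hPt hQ h0 n.
  rewrite hS => e; apply (rel n).2; exact: e.
have hQ : threefold_recurrence (derived_seq P) h.
  apply: derived_threefold hPt h0 _ _ => n.
    by rewrite hS; apply/rel.
  (* Here c_n = (n+1) gamma_(n+2) (1 - vartheta_(n+1)), so c_(n+2) h_(n+1) = gamma_(n+4) c_n is the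
     shift identity times (n+1) gamma_(n+2) gamma_(n+4). *)
  have vS : (1 - vartheta t1 t2 n.+3) * vartheta t1 t2 n.+1
      = 1 - vartheta t1 t2 n.+1 := vartheta_shift ht n.
  have c := congr1 (fun z => (n%:R + 1) * gamma n.+2 * gamma n.+4 * z) vS.
  rewrite /h -[n.+3%:R]natr1 -[n.+2%:R]natr1 -[n.+1%:R]natr1.
  apply: (eq_by_sub c); field.
  by rewrite -!addrA -!(natrD _ 1) !natD.
split=> //; apply: (two_orthogonal_threefold hQ) => n.
rewrite hS !mulf_neq0 ?invr_eq0 ?(natD n 0) //.
by rewrite -addrA -(natrD _ 1) natD.
Qed.
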